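(* Let $n\ge0$ and let $\sigma,\tau\in\mathrm{Typ}(n)$ be types of $n$. (1) The coefficient of $E_\tau$ in the expansion of $H_\sigma$ in the basis $\{E_\rho:\rho\in\mathrm{Typ}(n)\}$ is $(-1)^{\ell(\tau)}\,|\mathcal{PT}^{\mathrm{simp}}(\sigma,\tau)|$. (2) The coefficient of $H_\tau$ in the expansion of $E_\sigma$ in the basis $\{H_\rho:\rho\in\mathrm{Typ}(n)\}$ is $(-1)^{\ell(\tau)}\,|\mathcal{PT}^{\mathrm{simp}}(\sigma,\tau)|$.
   Context: A type of $n$ is a sequence $\tau=(\tau|^1,\tau|^2,\dots)$ of (possibly empty) integer partitions with $\sum_{i\ge1} i\,|\tau|^i|=n$, where $|\tau|^i|$ is the size of the partition $\tau|^i$; $\mathrm{Typ}(n)$ is the set of types of $n$. Its length is $\ell(\tau)=\sum_i\ell(\tau|^i)$, the total number of parts. Each part $d$ of $\tau|^r$ gives a block $d^r$ of $\tau$ (degree $d$, multiplicity $r$; not exponentiation). Let $x_{i,j}$ ($i,j\ge 1$) be indeterminates with $\deg x_{i,j}=i$; all series have rational coefficients. A monomial is square-free if every exponent is at most $1$. $H_d$ is the sum of all monomials of degree $d$; $E_d$ is the sum over square-free monomials $f$ of degree $d$ of $(-1)^{m(f)}f$, where $m(f)$ is the number of indeterminates in $f$. For $F\in\{H,E\}$, $F_{d^r}$ is obtained from $F_d$ by replacing each $x_{i,j}$ by $x_{i,j}^r$, and $F_\tau=\prod F_{d^r}$ over all blocks $d^r$ of $\tau$ (counted with repetition; empty product $=1$).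 It is known that $\{H_\tau\}_{\tau\in\mathrm{Typ}(n)}$ and $\{E_\tau\}_{\tau\in\mathrm{Typ}(n)}$ are $\mathbb{Q}$-bases of the space $\mathrm{PSym}(n)$ of polysymmetric functions of degree $n$ (power series homogeneous of degree $n$ that are symmetric separately in each variable set $\{x_{i,j}\}_{j\ge1}$). The diagram of a partition $\lambda$ has left-justified rows of $\lambda_1,\lambda_2,\dots$ cells. A brick is a nonempty set of consecutive cells in one row; its length is its number of cells. A brick tabloid of shape $\lambda$ and content $\mu$ ($\lambda,\mu$ partitions) is a decomposition of the diagram of $\lambda$ into disjoint bricks whose multiset of lengths is the multiset of parts of $\mu$. A simple polybrick tabloid of shape $\sigma$ and content $\tau$ is a sequence $(T_i)_{i\ge1}$ where $T_i$ is a brick tabloid of shape $\sigma|^i$ and content $\tau|^i$ for each $i$. $\mathcal{PT}^{\mathrm{simp}}(\sigma,\tau)$ is the set of these. *)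

(* Defs.v *)
From HB Require Import structures.
From mathcomp Require Import all_boot all_order all_algebra.
From mathcomp Require Import finmap.
From mathcomp Require Import monalg.

Set Implicit Arguments.
Unset Strict Implicit.
Unset Printing Implicit Defensive.

Import GRing.Theory.

Local Open Scope ring_scope.

(** * Partitions and types *)

Definition is_part (s : seq nat) : bool := sorted geq s && (0 \notin s)%N.

Record intpart := IntPart { parts :> seq nat; partsP : is_part parts }.

HB.instance Definition _ := [isSub for parts].
HB.instance Definition _ := [Countable of intpart by <:].

(** A type of [n] has [i * |tau|^i| <= n], so its components of index [i > n]
    are empty: only the first [n] components are recorded, and the component
    [tau|^i] is [tnth tau] at the index [i - 1]. *)
Definition is_type n (t : n.-tuple intpart) : bool :=
  (\sum_(i < n) i.+1 * sumn (tnth t i))%N == n.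

Record typ (n : nat) := Typ { comps :> n.-tuple intpart; typP : is_type comps }.

HB.instance Definition _ n := [isSub for @comps n].
HB.instance Definition _ n := [Countable of typ n by <:].

Definition typ_len n (t : typ n) : nat := (\sum_(i < n) size (tnth t i))%N.

Lemma mem_leq_sumn (s : seq nat) x : x \in s -> (x <= sumn s)%N.
Proof.
elim: s => //= y s IHs; rewrite inE => /predU1P[->|/IHs]; first exact: leq_addr.
by move/leq_trans; apply; apply: leq_addl.
Qed.

Lemma size_leq_sumn (s : seq nat) : (0 \notin s)%N -> (size s <= sumn s)%N.
Proof.
elim: s => //= y s IHs; rewrite inE negb_or eq_sym -lt0n => /andP[y0 /IHs].
by rewrite -add1n; apply: leq_add.
Qed.

Lemma sumn_comp_leq n (t : typ n) i : (sumn (tnth t i) <= n)%N.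
Proof.
have /eqP e := typP t; rewrite -[X in (_ <= X)%N]e (bigD1 i) //= mulSn -addnA.
exact: leq_addr.
Qed.

Definition empty_part : intpart := @IntPart [::] isT.

Definition typ_code n (t : typ n) : n.-tuple (n.-bseq 'I_n.+1) :=
  [tuple insub_bseq n [seq inord x | x <- tnth t i] | i < n].

Definition typ_decode n (u : n.-tuple (n.-bseq 'I_n.+1)) : option (typ n) :=
  insub [tuple insubd empty_part [seq val x | x <- tnth u i] | i < n].

Lemma typ_codeK n : pcancel (@typ_code n) (@typ_decode n).
Proof.
move=> t; rewrite /typ_decode.
suff -> : [tuple insubd empty_part [seq val x | x <- tnth (typ_code t) i] | i < n]
          = val t by rewrite valK.
apply: eq_from_tnth => i; rewrite tnth_mktuple tnth_mktuple.
have le_n := sumn_comp_leq t i; set p := tnth t i in le_n *.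
have /andP[_ p0] := partsP p.
rewrite val_insubd /= ifT ?size_map ?(leq_trans (size_leq_sumn p0)) //.
rewrite -map_comp map_id_in; first by apply: val_inj; rewrite val_insubd partsP.
by move=> x px; rewrite /= inordK // ltnS (leq_trans (mem_leq_sumn px)).
Qed.

HB.instance Definition _ n :=
  isFinite.Build (typ n) (pcan_enumP (@typ_codeK n)).

(** * Power series in the indeterminates [x_{i,j}], [i, j >= 1] *)

(** The pair [(i, j)] stands for [x_{i+1,j+1}]. *)
Definition var : choiceType := (nat * nat)%type.
Definition vdeg (v : var) : nat := v.1.+1.

Definition monom := {cmonom var}.
Definition wdeg (m : monom) : nat := (\sum_(v <- finsupp m) vdeg v * m v)%N.
Definition sqfree (m : monom) : bool := [forall v : finsupp m, m (val v) <= 1]%N.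

(** A series is its family of coefficients. *)
Definition series := monom -> rat.

Definition sone : series := fun m => (m == mone)%:R.

(** Cauchy product; [b] ranges over the exponent vectors of the divisors of
    [m]. *)
Definition smul (f g : series) : series := fun m =>
  \sum_(b : {dffun forall v : finsupp m, 'I_(m (val v)).+1})
     f [cmonom (b v : nat) | v : finsupp m]%M
     * g [cmonom (m (val v) - b v)%N | v : finsupp m]%M.

(** The series obtained by replacing every [x_{i,j}] by [x_{i,j} ^ r]
    ([r >= 1]): the coefficient of [m] is that of [m'] when [m = m' ^ r], and
    [0] when [m] is not an [r]-th power. *)
Definition psubst (r : nat) (f : series) : series := fun m =>
  if [forall v : finsupp m, r %| m (val v)]%N
  then f [cmonom (m (val v) %/ r)%N | v : finsupp m]%M else 0.

Definition Hdeg (d : nat) : series := fun m => (wdeg m == d)%:R.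

Definition Edeg (d : nat) : series := fun m =>
  if (wdeg m == d) && sqfree m then (-1) ^+ #|` finsupp m| else 0.

(** The product of the [F_{d^r}] over the blocks [d^r] of [t]. *)
Definition block_prod (F : nat -> series) n (t : typ n) : series :=
  \big[smul/sone]_(i < n) \big[smul/sone]_(d <- tnth t i) psubst i.+1 (F d).

Definition Hpoly n (t : typ n) : series := block_prod Hdeg t.
Definition Epoly n (t : typ n) : series := block_prod Edeg t.

Definition expands n (B : typ n -> series) (f : series) (c : typ n -> rat) : Prop :=
  forall m, f m = \sum_(rho : typ n) c rho * B rho m.

(** [a] is the coefficient of [B tau] in the expansion of [f] in the family
    [B]: this asserts that the expansion exists and is unique. *)
Definition is_coef n (B : typ n -> series) (f : series) (tau : typ n) (a : rat)
    : Prop :=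
  exists c : typ n -> rat,
    [/\ expands B f c, (forall c', expands B f c' -> c' =1 c) & c tau = a].

(** * Brick tabloids *)

(** The cell [(i, j)] is in row [i] and column [j], both counted from [0]; the
    diagram lives in the rectangle with [size la] rows and [la_1] columns. *)
Definition cell (la : intpart) : finType := ('I_(size la) * 'I_(head 0%N la))%type.

Definition diagram (la : intpart) : {set cell la} :=
  [set c : cell la | c.2 < nth 0 la c.1]%N.

Definition is_brick (la : intpart) (B : {set cell la}) : bool :=
  [exists i : 'I_(size la), exists a : 'I_(head 0%N la),
     exists b : 'I_(head 0%N la),
     (a <= b)%N && (B == [set c : cell la | (c.1 == i) && (a <= c.2 <= b)%N])].

Definition brick_tabloids (la mu : intpart) : {set {set {set cell la}}} :=
  [set T : {set {set cell la}} |
    [&& partition T (diagram la),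
        [forall B in T, is_brick B] &
        perm_eq [seq #|(B : {set cell la})| | B <- enum T] mu]].

(** The components of index [i > n], all empty, have exactly one brick
    tabloid, and are left out. *)
Definition PTsimp n (sigma tau : typ n)
    : {set {dffun forall i : 'I_n, {set {set cell (tnth sigma i)}}}} :=
  [set T : {dffun forall i : 'I_n, {set {set cell (tnth sigma i)}}} |
    [forall i : 'I_n, T i \in brick_tabloids (tnth sigma i) (tnth tau i)]].

(* Main.v *)
(** Setting [F(t) = sum_d F_d t^d], one has [H(t) = prod_v 1 / (1 - x_v t^(deg v))]
    and [E(t) = prod_v (1 - x_v t^(deg v))], so [H(t) E(t) = 1]: each of the two
    families satisfies [G_d = - sum_(0 < k <= d) F_k G_(d - k)] in terms of the
    other, and so do their images under [x -> x ^ r]. Cutting off the last brick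
    of a row shows that the sum over the brick tabloids [T] of shape [lambda] of
    [prod_(B in T) (- F_|B|)] satisfies the same recursion, hence equals
    [prod_i G_(lambda_i)]. Multiplying over the components and sorting the
    tabloids by content gives both expansions, with one and the same matrix [M].

    The [H_rho] are linearly independent by a triangularity argument. To a
    monomial attach the multiset of the pairs (degree, exponent) of its
    variables, and to a multiset of blocks [d^r] the number
    [Phi = sum (d^2 r - d r^2)]. Each monomial of [H_rho] has a smaller [Phi]
    than the blocks of [rho], unless its multiset is that of the blocks of
    [rho], and some monomial of [H_rho] has exactly this multiset. Finally [M^2 = 1],
    which transfers the independence to the [E_rho]. *)

Require Import Defs.
From HB Require Import structures.
From mathcomp Require Import all_boot all_order all_algebra.
From mathcomp Require Import finmap.
From mathcomp Require Import monalg.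
From mathcomp Require Import boolp.
From mathcomp Require Import zify.

Set Implicit Arguments.
Unset Strict Implicit.
Unset Printing Implicit Defensive.

Import Order.TTheory GRing.Theory Num.Theory.

Local Open Scope ring_scope.

Local Notation "a ** b" := (@mmul monom a b) (at level 40, left associativity).

(** * The ring of series *)

Lemma monomP (a b : monom) : (forall v, a v = b v) -> a = b.
Proof. by move=> h; apply/eqP/cmP. Qed.

(** The index [b] of the sum in [smul], read as a monomial: the sum can then be rewritten over the
    list [divs m]. *)
Definition sub_monom (m : monom)
    (b : {dffun forall v : finsupp m, 'I_(m (val v)).+1}) : monom :=
  [cmonom (b v : nat) | v : finsupp m]%M.

Lemma sub_monomE (m : monom) b (v : finsupp m) : @sub_monom m b (val v) = b v.
Proof.
rewrite /sub_monom cmE fsfun_ffun; case: insubP => [u _ uv|]; last by rewrite (valP v).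
by rewrite (val_inj uv).
Qed.

Lemma sub_monom_out (m : monom) b v : v \notin finsupp m -> @sub_monom m b v = 0%N.
Proof. by move=> h; rewrite /sub_monom cmE fsfun_ffun insubN. Qed.

Lemma sub_monom_inj (m : monom) : injective (@sub_monom m).
Proof.
move=> b c e; apply/ffunP=> v; apply: val_inj.
by move: (sub_monomE b v); rewrite e (sub_monomE c v); symmetry.
Qed.

Definition divs (m : monom) : seq monom :=
  [seq sub_monom b | b : {dffun forall v : finsupp m, 'I_(m (val v)).+1}].

Lemma divs_uniq m : uniq (divs m).
Proof. by rewrite map_inj_uniq ?enum_uniq //; apply: sub_monom_inj. Qed.

(** [divcm] subtracts exponents with truncation at 0, so multiplying back by [a] restores [m] only
    when [a] divides [m]. *)
Lemma mem_divs m a : (a \in divs m) = (a ** divcm m a == m).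
Proof.
apply/imageP/eqP => [[b _ ->]|e].
  apply: monomP=> v; rewrite cmM divcmE.
  have [vm|vm] := boolP (v \in finsupp m); last first.
    by rewrite sub_monom_out // add0n subn0.
  by rewrite subnKC // (sub_monomE b [` vm]%fset) -ltnS.
have le v : (a v <= m v)%N by rewrite -e cmM leq_addr.
exists [ffun v : finsupp m => inord (a (val v))] => //.
apply: monomP => v; have [vm|vm] := boolP (v \in finsupp m).
  by rewrite (sub_monomE _ [` vm]%fset) ffunE inordK ?ltnS.
by rewrite sub_monom_out //; have := le v; rewrite (fsfun_dflt vm) leqn0 => /eqP.
Qed.

Lemma divcm_mul (a b : monom) : divcm (a ** b) a = b.
Proof. by apply: monomP=> v; rewrite divcmE cmM addKn. Qed.

Lemma mem_divs_mull a b : a \in divs (a ** b).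
Proof. by rewrite mem_divs divcm_mul. Qed.

Lemma mem_divs_mulr a b : b \in divs (a ** b).
Proof. by rewrite mulmC mem_divs_mull. Qed.

Lemma smulE f g m : smul f g m = \sum_(a <- divs m) f a * g (divcm m a).
Proof.
rewrite /smul big_image /=; apply: eq_bigr => b _.
congr (_ * g _); apply: monomP => v; rewrite divcmE.
have [vm|vm] := boolP (v \in finsupp m); last first.
  rewrite cmE fsfun_ffun insubN // sub_monom_out //.
  by rewrite (fsfun_dflt vm).
by rewrite (sub_monomE _ [` vm]%fset) cmE fsfun_ffun insubT.
Qed.

(** The freedom in [K] serves [smul_triples]: the inner product, taken at a divisor of [m], can be
    summed over all of [divs m], and the sums become exchangeable. *)
Lemma smul_pairs (K : seq monom) f g m : uniq K -> {subset divs m <= K} ->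
  smul f g m = \sum_(a <- K) \sum_(b <- K | a ** b == m) f a * g b.
Proof.
move=> Ku sK; rewrite smulE.
transitivity (\sum_(a <- K | a \in divs m) f a * g (divcm m a)).
  rewrite -[RHS]big_filter; apply: perm_big; apply: uniq_perm.
  - exact: divs_uniq.
  - exact: filter_uniq.
  - by move=> a; rewrite mem_filter; case: (boolP (a \in _)) => // /sK ->.
rewrite big_mkcond; apply: eq_bigr => a _; case: ifP => [|/negbT am].
  rewrite mem_divs => /eqP am.
  have Kma : divcm m a \in K by apply: sK; rewrite -{2}am mem_divs_mulr.
  rewrite -big_filter (bigD1_seq (divcm m a)) ?filter_uniq ?mem_filter ?am ?eqxx //=.
  rewrite big_filter_cond big1 ?addr0 // => b /andP[/eqP <-].
  by rewrite divcm_mul eqxx.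
rewrite big1 // => b /eqP e; case/negP: am.
by rewrite -e mem_divs_mull.
Qed.

Lemma smulC : commutative smul.
Proof.
move=> f g; apply: funext => m.
rewrite !(smul_pairs _ _ (divs_uniq m) (fun _ => id)).
rewrite (exchange_big_dep predT) //=; apply: eq_bigr => a _.
under eq_bigl do rewrite mulmC.
by apply: eq_bigr => b _; rewrite mulrC.
Qed.

Lemma divs_trans (a b c : monom) : a \in divs b -> b \in divs c -> a \in divs c.
Proof.
rewrite mem_divs => /eqP <-; rewrite mem_divs => /eqP <-.
by rewrite -mulmA mem_divs_mull.
Qed.

Lemma smul_triples (f g h : series) m :
  smul (smul f g) h m =
  \sum_(a <- divs m) \sum_(b <- divs m) \sum_(c <- divs m)
     if a ** b ** c == m then f a * g b * h c else 0.
Proof.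
rewrite (smul_pairs _ _ (divs_uniq m) (fun _ => id)).
transitivity (\sum_(e <- divs m) \sum_(c <- divs m) \sum_(a <- divs m)
   \sum_(b <- divs m)
     if (a ** b == e) && (e ** c == m) then f a * g b * h c else 0).
  rewrite !big_seq; apply: eq_bigr => e em; rewrite big_mkcond.
  apply: eq_bigr => c _; case: ifP => _; last first.
    by rewrite big1 // => a _; rewrite big1 // => b _; rewrite andbF.
  rewrite (@smul_pairs (divs m)) ?divs_uniq //; last first.
    by move=> a /divs_trans; apply.
  rewrite mulr_suml; apply: eq_bigr => a _; rewrite mulr_suml big_mkcond.
  by apply: eq_bigr => b _; rewrite andbT.
under eq_bigr do rewrite exchange_big; rewrite exchange_big /=; apply: eq_bigr => a _.
under eq_bigr do rewrite exchange_big; rewrite exchange_big /=; apply: eq_bigr => b _.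
rewrite exchange_big; apply: eq_bigr => c _.
rewrite -big_mkcond; case: eqP => [e|ne].
  have abm : a ** b \in divs m by rewrite -e mem_divs_mull.
  rewrite -big_filter (bigD1_seq (a ** b)) ?filter_uniq ?divs_uniq //=; last first.
    by rewrite mem_filter eqxx e eqxx.
  by rewrite big_filter_cond big1 ?addr0 // => d /andP[/andP[/eqP -> _]]; rewrite eqxx.
by rewrite big1 // => d /andP[/eqP <- /eqP].
Qed.

Lemma smulA : associative smul.
Proof.
(* With [f] moved to the right, both sides are left-nested products, hence sums over the same
   triples in a different order. *)
move=> f g h; rewrite (smulC f); apply: funext => m; rewrite !smul_triples.
under [LHS]eq_bigr do rewrite exchange_big.
rewrite [LHS]exchange_big; apply: eq_bigr => a _; apply: eq_bigr => b _.
apply: eq_bigr => c _; rewrite -(mulmA a) (mulmC a).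
by rewrite -(mulrA (f a)) (mulrC (f a)).
Qed.

Lemma smul1f : left_id sone smul.
Proof.
move=> f; apply: funext => m; rewrite smulE.
have d1 : mone \in divs m by rewrite -(mul1m m) mem_divs_mull.
rewrite (bigD1_seq mone) ?divs_uniq //= big1 => [|a /negbTE a1]; last first.
  by rewrite /sone a1 mul0r.
rewrite /sone eqxx mul1r addr0 -{1}(mul1m m).
by rewrite divcm_mul.
Qed.

(** Series are functions, so the equality and choice structures underlying the ring structure are
    the classical ones. *)
HB.instance Definition _ := gen_eqMixin series.
HB.instance Definition _ := gen_choiceMixin series.

Definition sadd (f g : series) : series := fun m => f m + g m.
Definition sopp (f : series) : series := fun m => - f m.
Definition szero : series := fun _ => 0.

Lemma saddA : associative sadd.
Proof. by move=> f g h; apply: funext => m; apply: addrA. Qed.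

Lemma saddC : commutative sadd.
Proof. by move=> f g; apply: funext => m; apply: addrC. Qed.

Lemma sadd0f : left_id szero sadd.
Proof. by move=> f; apply: funext => m; apply: add0r. Qed.

Lemma saddNf : left_inverse szero sopp sadd.
Proof. by move=> f; apply: funext => m; apply: addNr. Qed.

HB.instance Definition _ := GRing.isZmodule.Build series saddA saddC sadd0f saddNf.

Lemma smulDl : left_distributive smul sadd.
Proof.
move=> f g h; apply: funext => m; rewrite /sadd !smulE -big_split /=.
by apply: eq_bigr => a _; rewrite mulrDl.
Qed.

Lemma sone_neq0 : sone != 0 :> series.
Proof.
by apply/eqP => /(congr1 (fun f : series => f mone)); rewrite /sone eqxx.
Qed.

HB.instance Definition _ :=
  GRing.Zmodule_isComNzRing.Build series smulA smulC smul1f smulDl sone_neq0.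

Lemma series1E m : (1 : series) m = (m == mone)%:R. Proof. by []. Qed.
Lemma seriesDE (f g : series) m : (f + g) m = f m + g m. Proof. by []. Qed.
Lemma seriesNE (f : series) m : (- f) m = - f m. Proof. by []. Qed.
Lemma seriesME (f g : series) m :
  (f * g) m = \sum_(a <- divs m) f a * g (divcm m a).
Proof. exact: smulE. Qed.

Lemma series_sumE I (r : seq I) (P : pred I) (F : I -> series) m :
  (\sum_(i <- r | P i) F i) m = \sum_(i <- r | P i) F i m.
Proof. exact: (big_morph (fun f : series => f m) (fun f g => seriesDE f g m)). Qed.

(** * The substitutions [x_{i,j} -> x_{i,j} ^ r] *)

Definition mpow (r : nat) (m : monom) : monom :=
  [cmonom (r * m v)%N | v in finsupp m]%M.

Lemma mpowE r m v : mpow r m v = (r * m v)%N.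
Proof. by rewrite /mpow cmE fsfun_fun; case: finsuppP => //; rewrite muln0. Qed.

Lemma mpowM r (a b : monom) : mpow r (a ** b) = mpow r a ** mpow r b.
Proof. by apply: monomP => v; rewrite cmM !mpowE cmM mulnDr. Qed.

Lemma mpow1 r : mpow r mone = mone.
Proof. by apply: monomP => v; rewrite mpowE !cm1 muln0. Qed.

Lemma mpow_inj r : (0 < r)%N -> injective (mpow r).
Proof.
move=> r0 a b e; apply: monomP => v; apply/eqP.
by rewrite -(eqn_pmul2l r0) -!mpowE e.
Qed.

Lemma finsupp_mpow r (m : monom) : (0 < r)%N -> finsupp (mpow r m) = finsupp m.
Proof.
move=> r0; apply/fsetP => v; rewrite -!cmE_neq0 mpowE muln_eq0 negb_or.
by rewrite -lt0n r0.
Qed.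

Lemma psubst_mpow r f m : (0 < r)%N -> psubst r f (mpow r m) = f m.
Proof.
move=> r0; rewrite /psubst ifT; last first.
  by apply/forallP => v; rewrite mpowE dvdn_mulr.
congr f; apply: monomP => v; rewrite cmE fsfun_ffun.
case: insubP => [u _ uv|]; first by rewrite -uv /= mpowE mulKn.
by rewrite finsupp_mpow // => /fsfun_dflt ->.
Qed.

(** Trades the divisibility test in [psubst] for the alternative used in proofs: [m] is an [r]-th
    power with an explicit root, or the coefficient is 0. *)
Variant psubst_spec r f (m : monom) : rat -> Type :=
| PsubstPow a of m = mpow r a : psubst_spec r f m (f a)
| PsubstOut of (forall a, m <> mpow r a) : psubst_spec r f m 0.

Lemma psubstP r (f : series) m : (0 < r)%N -> psubst_spec r f m (psubst r f m).
Proof.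
move=> r0; have [/forallP h|h] := boolP [forall v : finsupp m, (r %| m (val v))%N].
  pose a : monom := [cmonom (m v %/ r)%N | v in finsupp m]%M.
  suff e : m = mpow r a by rewrite {2}e psubst_mpow //; constructor.
  apply: monomP => v; rewrite mpowE /a cmE fsfun_fun.
  case: finsuppP => [|vm]; first by rewrite muln0.
  by rewrite mulnC divnK //; apply: (h [` vm]%fset).
rewrite /psubst (negbTE h); constructor => a e; case/negP: h.
by rewrite e; apply/forallP => v; rewrite mpowE dvdn_mulr.
Qed.

Lemma psubst1 r : (0 < r)%N -> psubst r 1 = 1.
Proof.
move=> r0; apply: funext => m; case: psubstP => // [a ->|ne].
  rewrite !series1E; congr (_%:R); rewrite -{2}(mpow1 r).
  by rewrite (inj_eq (mpow_inj r0)).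
by rewrite series1E; case: eqP => // e; case: (ne mone); rewrite mpow1.
Qed.

(** A term of the product on the right is nonzero only if both the divisor and its cofactor are
    [r]-th powers. Then so is their product, and the root of the divisor divides the root of the
    product; the terms thus match those of [f * g] at the root. *)
Lemma psubstM r f g : (0 < r)%N -> psubst r (f * g) = psubst r f * psubst r g.
Proof.
move=> r0; apply: funext => m; rewrite seriesME; case: psubstP => // [p ->|ne].
  transitivity (\sum_(a <- [seq mpow r a | a <- divs p])
     psubst r f a * psubst r g (divcm (mpow r p) a)).
    rewrite big_map seriesME big_seq [RHS]big_seq; apply: eq_bigr => a.
    rewrite mem_divs => /eqP e.
    by rewrite -{2}e mpowM divcm_mul !psubst_mpow.
  transitivity (\sum_(a <- divs (mpow r p) | a \in [seq mpow r a | a <- divs p])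
     psubst r f a * psubst r g (divcm (mpow r p) a)).
    rewrite -[RHS]big_filter; apply: perm_big; apply: uniq_perm.
    - by rewrite map_inj_uniq ?divs_uniq //; apply: mpow_inj.
    - by rewrite filter_uniq ?divs_uniq.
    - move=> a; rewrite mem_filter andb_idr // => /mapP[b].
      by rewrite mem_divs => /eqP e ->; rewrite -e mpowM mem_divs_mull.
  rewrite [LHS]big_mkcond big_seq [RHS]big_seq; apply: eq_bigr => a.
  rewrite mem_divs => /eqP e; case: ifP => // /negP na.
  case: psubstP => // [b eb|]; last by rewrite mul0r.
  case: psubstP => // [c ec|]; last by rewrite mulr0.
  case: na; apply/mapP; exists b => //.
  have -> : p = b ** c by apply: (mpow_inj r0); rewrite mpowM -eb -ec.
  exact: mem_divs_mull.
rewrite big_seq big1 // => a; rewrite mem_divs => /eqP e.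
case: psubstP => // [b eb|]; last by rewrite mul0r.
case: psubstP => // [c ec|]; last by rewrite mulr0.
by case: (ne (b ** c)); rewrite mpowM -eb -ec.
Qed.

Lemma psubst_sum r I (s : seq I) (P : pred I) (F : I -> series) : (0 < r)%N ->
  psubst r (\sum_(i <- s | P i) F i) = \sum_(i <- s | P i) psubst r (F i).
Proof.
move=> r0; apply: funext => m; rewrite series_sumE.
have [[a ->]|ne] := pselect (exists a, m = mpow r a).
  rewrite psubst_mpow // series_sumE; apply: eq_bigr => i _.
  by rewrite psubst_mpow.
have h f : psubst r f m = 0 by case: psubstP => // a e; case: ne; exists a.
by rewrite h big1.
Qed.

(** * The relation [H E = 1] *)

Lemma wdeg_sub (m : monom) (K : {fset var}) : (finsupp m `<=` K)%fset ->
  wdeg m = (\sum_(v <- K) vdeg v * m v)%N.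
Proof.
move=> s; rewrite /wdeg; apply: (big_fset_incl _ s) => v _ /fsfun_dflt ->.
by rewrite muln0.
Qed.

Lemma wdegM (a b : monom) : wdeg (a ** b) = (wdeg a + wdeg b)%N.
Proof.
rewrite (@wdeg_sub (a ** b) (finsupp a `|` finsupp b)%fset) ?mdomD //.
rewrite (wdeg_sub (fsubsetUl (finsupp a) (finsupp b))).
rewrite (wdeg_sub (fsubsetUr (finsupp a) (finsupp b))) -big_split /=.
by apply: eq_bigr => v _; rewrite cmM mulnDr.
Qed.

Lemma wdeg_eq0 m : (wdeg m == 0%N) = (m == mone).
Proof.
apply/eqP/eqP => [e|->]; last by rewrite /wdeg mdom1 big_seq_fset0.
apply: monomP => v; rewrite cm1; case: (finsuppP m v) => // vm.
move: e; rewrite /wdeg (big_fsetD1 v) //= => /eqP; rewrite addn_eq0 muln_eq0.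
by case/andP => /eqP.
Qed.

Lemma Hdeg0 : Hdeg 0 = 1.
Proof. by apply: funext => m; rewrite /Hdeg wdeg_eq0. Qed.

Lemma Edeg0 : Edeg 0 = 1.
Proof.
apply: funext => m; rewrite /Edeg wdeg_eq0 series1E.
case: eqP => //= ->; rewrite mdom1 cardfs0 ifT //.
by apply/forallP => v; rewrite cm1.
Qed.

(** The square-free monomial with support [S]; these are exactly the square-free divisors of [m]. *)
Definition indic (m : monom) (S : {set finsupp m}) : monom :=
  [cmonom (v \in S : nat) | v : finsupp m]%M.

Lemma indicE (m : monom) (S : {set finsupp m}) (v : finsupp m) :
  indic S (val v) = (v \in S) :> nat.
Proof.
rewrite /indic cmE fsfun_ffun; case: insubP => [u _ uv|]; last by rewrite (valP v).
by rewrite (val_inj uv).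
Qed.

Lemma indic_out (m : monom) (S : {set finsupp m}) v :
  v \notin finsupp m -> indic S v = 0%N.
Proof. by move=> h; rewrite /indic cmE fsfun_ffun insubN. Qed.

Lemma card_finsupp_indic (m : monom) (S : {set finsupp m}) :
  #|` finsupp (indic S)| = #|S|.
Proof.
have -> : finsupp (indic S) = [fset val v | v in S]%fset.
  apply/fsetP => v; rewrite -cmE_neq0; have [vm|vm] := boolP (v \in finsupp m).
    rewrite (indicE S [` vm]%fset) eqb0 negbK.
    apply/idP/imfsetP => [h|[u uS e]]; first by exists [` vm]%fset.
    by have -> : [` vm]%fset = u by apply: val_inj.
  rewrite indic_out // eqxx; apply/esym/negP => /imfsetP[u _ e].
  by case/negP: vm; rewrite e (valP u).
rewrite card_imfset ?cardE //; exact: val_inj.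
Qed.

Lemma sqfreeP (m : monom) : reflect (forall v, (m v <= 1)%N) (sqfree m).
Proof.
apply: (iffP forallP) => h v; last exact: h.
by case: (finsuppP m v) => // vm; apply: (h [` vm]%fset).
Qed.

Lemma perm_divs_sqfree (m : monom) :
  perm_eq [seq a <- divs m | sqfree a] [seq indic A | A : {set finsupp m}].
Proof.
apply: uniq_perm.
- by rewrite filter_uniq ?divs_uniq.
- rewrite map_inj_in_uniq ?enum_uniq // => S T _ _ e; apply/setP => v.
  by move: (indicE S v); rewrite e (indicE T v); case: (v \in S); case: (v \in T).
- move=> a; rewrite mem_filter mem_divs; apply/andP/imageP => [[/sqfreeP sq /eqP e]|].
    have le v : (a v <= m v)%N by rewrite -e cmM leq_addr.
    exists [set v | a (val v) == 1%N] => //; apply: monomP => v.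
    have [vm|vm] := boolP (v \in finsupp m).
      rewrite (indicE _ [` vm]%fset) inE /=.
      by have := sq v; case: (a v) => [|[]].
    by rewrite indic_out //; have := le v; rewrite (fsfun_dflt vm) leqn0 => /eqP.
  case=> S _ ->; split.
    apply/sqfreeP => v; have [vm|vm] := boolP (v \in finsupp m).
      by rewrite (indicE _ [` vm]%fset) leq_b1.
    by rewrite indic_out.
  apply/eqP; apply: monomP => v; rewrite cmM divcmE.
  have [vm|vm] := boolP (v \in finsupp m); last by rewrite indic_out // subn0.
  rewrite subnKC // (indicE _ [` vm]%fset) (leq_trans (leq_b1 _)) // lt0n.
  by rewrite cmE_neq0.
Qed.

(** The sum over subsets of the support is the expansion of a product of factors [-1 + 1], one per
    variable of [m]; it vanishes unless the support is empty. *)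
Lemma sum_sign_divs (m : monom) :
  \sum_(a <- divs m | sqfree a) (-1) ^+ #|` finsupp a| = (m == mone)%:R :> rat.
Proof.
rewrite -big_filter (perm_big _ (perm_divs_sqfree m)) big_image /=.
under eq_bigr do rewrite card_finsupp_indic.
transitivity (\prod_(v : finsupp m) (-1 + 1 : rat)).
  rewrite bigA_distr; apply: eq_bigr => S _.
  by rewrite -big_mkcond /= prodr_const.
rewrite addNr prodr_const expr0n -cardfE cardfs_eq0.
congr (nat_of_bool _)%:R; apply/eqP/eqP => [e|->]; last exact: mdom1.
by apply: monomP => v; rewrite cm1 (@fsfun_dflt _ _ _ m) // e.
Qed.

(** At a fixed [m], a square-free divisor [a] contributes only for [k = wdeg a], and its cofactor
    then has degree [d - k] exactly when [wdeg m = d]. What remains is [sum_sign_divs]. *)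
Lemma sum_EH d : \sum_(k < d.+1) Edeg k * Hdeg (d - k) = (d == 0%N)%:R.
Proof.
apply: funext => m; rewrite series_sumE.
under eq_bigr do rewrite seriesME.
rewrite exchange_big /=.
transitivity (\sum_(a <- divs m | sqfree a)
    ((wdeg m == d)%:R * (-1) ^+ #|` finsupp a| : rat)).
  rewrite [RHS]big_mkcond big_seq [RHS]big_seq; apply: eq_bigr => a.
  rewrite mem_divs => /eqP e; have := wdegM a (divcm m a); rewrite e => wm.
  case: ifP => sq; last by rewrite big1 // => k _; rewrite /Edeg sq andbF mul0r.
  have [wd|wd] := leqP (wdeg a) d.
    rewrite (bigD1 (inord (wdeg a))) //= inordK // big1 => [|k].
      rewrite /Edeg /Hdeg eqxx sq /= addr0 mulrC; congr (_%:R * _).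
      by rewrite wm -{2}(subnKC wd) eqn_add2l.
    rewrite -val_eqE /= inordK // eq_sym /Edeg => /negbTE ->.
    by rewrite mul0r.
  (* Here no index [k] reaches [wdeg a], and [wdeg m >= wdeg a > d] makes the other side vanish
     too. *)
  rewrite big1 => [|k _].
    by rewrite gtn_eqF ?mul0r // wm (leq_trans wd) // leq_addr.
  by rewrite /Edeg gtn_eqF ?mul0r // (leq_ltn_trans _ wd) // -ltnS.
rewrite -mulr_sumr sum_sign_divs -natrM mulnb -wdeg_eq0.
have -> : ((d == 0)%N%:R : series) m = ((d == 0) && (m == mone))%N%:R.
  by case: (d == 0)%N.
rewrite -wdeg_eq0; congr (_%:R); congr nat_of_bool.
by case: (wdeg m =P 0%N) => [->|_]; rewrite ?andbF // eq_sym.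
Qed.

(** * Generating function of brick tilings *)

Section Tilings.

Variables p q : nat.
Implicit Types (l : 'I_p -> nat) (B : {set 'I_p * 'I_q}) (T : {set {set 'I_p * 'I_q}}).

Definition interval (i : 'I_p) (a b : nat) : {set 'I_p * 'I_q} :=
  [set c : 'I_p * 'I_q | (c.1 == i) && (a <= c.2 <= b)%N].

Definition is_interval B : bool :=
  [exists i : 'I_p, exists a : 'I_q, exists b : 'I_q,
     (a <= b)%N && (B == interval i a b)].

(** Row lengths are arbitrary, because cutting a brick off a row of a partition may leave rows that
    are no longer decreasing. *)
Definition region l : {set 'I_p * 'I_q} := [set c : 'I_p * 'I_q | (c.2 < l c.1)%N].

Definition tiling l T : bool :=
  partition T (region l) && [forall B in T, is_interval B].

Definition set_row l (i : 'I_p) (d : nat) (j : 'I_p) : nat := if j == i then d else l j.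

Lemma card_interval i (a b : nat) : (b < q)%N -> (a <= b)%N ->
  #|interval i a b| = (b - a).+1.
Proof.
move=> bq ab; pose f (k : 'I_(b - a).+1) : 'I_p * 'I_q :=
  (i, Ordinal (leq_ltn_trans (leq_trans (leq_add (leqnn a) (ltn_ord k : (k <= b - a)%N))
     (eq_leq (subnKC ab))) bq)).
have -> : interval i a b = [set f k | k in setT].
  apply/setP => -[j c]; rewrite inE /=; apply/idP/imsetP => [/and3P[/eqP -> ac cb]|].
    have h : (c - a < (b - a).+1)%N by rewrite ltnS leq_sub2r.
    by exists (Ordinal h) => //; congr pair; apply: val_inj; rewrite /= subnKC.
  by case=> k _ [-> ->] /=; rewrite eqxx leq_addr /= -{2}(subnKC ab) leq_add2l -ltnS.
rewrite card_imset ?cardsT ?card_ord // => k k' [] /addnI e.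
exact: val_inj.
Qed.

Section Step.

Variables (l : 'I_p -> nat) (i : 'I_p) (d : nat).
Hypotheses (lid : l i = d.+1) (dq : (d < q)%N).

(** Row [i] has [d.+1] cells and [c0] is its last one. The brick [last_brick k] ends there and has
    [k.+1] cells, so [k < d.+1] runs over all possible lengths. *)
Let c0 : 'I_p * 'I_q := (i, Ordinal dq).
Let last_brick (k : 'I_d.+1) := interval i (d - k) d.
Let rest (k : 'I_d.+1) := set_row l i (d - k).

Lemma mem_last_brick k : c0 \in last_brick k.
Proof. by rewrite inE /= eqxx leq_subr leqnn. Qed.

Lemma card_last_brick k : #|last_brick k| = k.+1.
Proof. by rewrite card_interval ?leq_subr // subKn // -ltnS. Qed.

Lemma last_brick_interval k : is_interval (last_brick k).
Proof.
apply/existsP; exists i; apply/existsP.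
exists (Ordinal (leq_ltn_trans (leq_subr k d) dq)).
by apply/existsP; exists (Ordinal dq); rewrite /= leq_subr eqxx.
Qed.

Lemma region_last_brick k : region l = last_brick k :|: region (rest k).
Proof.
apply/setP => -[j c]; rewrite !inE /= /rest /set_row; case: eqP => //= ->.
rewrite lid ltnS; case: (leqP (d - k) c) => /= h; first by rewrite orbF.
by rewrite (leq_trans (ltnW h)) ?leq_subr.
Qed.

Lemma disjoint_last_brick k : [disjoint last_brick k & region (rest k)].
Proof.
rewrite -setI_eq0; apply/eqP/setP => -[j c]; rewrite !inE /= /rest /set_row.
by case: eqP => //= _; rewrite ltnNge; case: leqP => //=; rewrite andbF.
Qed.

(** The bijection that deletes the last brick, in the form used for reindexing. The brick is not in
    a tiling of the shortened region, since it contains [c0], which lies outside that region. *)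
Lemma tiling_add_last k T :
  tiling (rest k) T = tiling l (last_brick k |: T) && (last_brick k \notin T).
Proof.
have Bn0 : last_brick k != set0 by apply/set0Pn; exists c0; apply: mem_last_brick.
apply/andP/andP => [[pT /forall_inP bT]|[/andP[pT /forall_inP bT] BT]].
  split; last first.
    apply/negP => /(partitionS pT) s; move: (disjoint_last_brick k).
    by move/pred0P/(_ c0); rewrite /= (subsetP s) mem_last_brick.
  apply/andP; split; last first.
    apply/forall_inP => B; rewrite !inE => /predU1P[->|/bT //].
    exact: last_brick_interval.
  by rewrite (region_last_brick k) partitionU1 ?disjoint_last_brick.
split; last by apply/forall_inP => B BT'; apply: bT; rewrite inE BT' orbT.
have := partitionD1 pT (setU11 _ _); rewrite setU1K //.
rewrite (region_last_brick k) setDUl setDv set0U.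
suff -> : region (rest k) :\: last_brick k = region (rest k) by [].
by apply/setDidPl; rewrite disjoint_sym disjoint_last_brick.
Qed.

(** The brick covering [c0] lies in row [i] and cannot extend beyond column [d], so it ends
    there. *)
Lemma exists_last_brick T : tiling l T -> exists k, last_brick k \in T.
Proof.
case/andP=> pT /forall_inP bT.
have : c0 \in cover T by rewrite (cover_partition pT) inE /= lid.
case/bigcupP => B BT cB.
have /existsP[j /existsP[a /existsP[b /andP[ab /eqP eB]]]] := bT _ BT.
move: (cB); rewrite eB inE /= => /and3P[/eqP ij ad db].
have bd : b = d :> nat.
  apply/eqP; rewrite eqn_leq db andbT.
  have : (j, b) \in region l.
    by apply: (subsetP (partitionS pT BT)); rewrite eB inE /= eqxx ab leqnn.
  by rewrite inE /= -ij lid.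
have h : (d - a < d.+1)%N by rewrite ltnS leq_subr.
exists (Ordinal h); suff -> : last_brick (Ordinal h) = B by [].
by rewrite eB /last_brick /= subKn // bd ij.
Qed.

Lemma uniq_last_brick T k k' : tiling l T ->
  last_brick k \in T -> last_brick k' \in T -> k = k'.
Proof.
case/andP=> pT _ Bk Bk'; have tI := partition_trivIset pT.
have e := def_pblock tI Bk (mem_last_brick k).
rewrite (def_pblock tI Bk' (mem_last_brick k')) in e.
by apply/val_inj/succn_inj; rewrite -!card_last_brick e.
Qed.

End Step.

Variables (R : comPzRingType) (x w : nat -> R).
Hypotheses (w0 : w 0%N = 1)
  (wS : forall d, w d.+1 = \sum_(k < d.+1) x k.+1 * w (d - k)%N).

(** [w d] is the weighted sum over the compositions of [d], built by splitting off one part. The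
    induction is on the number of cells: tilings are sorted by the brick that ends a chosen nonempty
    row. *)
Lemma tiling_sum l : (forall i, (l i <= q)%N) ->
  \sum_(T | tiling l T) \prod_(B in T) x #|B| = \prod_i w (l i).
Proof.
have [N] := ubnP (\sum_i l i)%N; elim: N l => // N IHN l lN lq.
have [/forallP l0|] := boolP [forall i, l i == 0%N].
  rewrite [RHS]big1 => [|i _]; last by rewrite (eqP (l0 i)).
  have r0 : region l = set0 by apply/setP => c; rewrite !inE (eqP (l0 _)).
  rewrite (big_pred1 set0) ?big_set0 // => T; rewrite /tiling r0 partition_set0.
  by apply: andb_idr => /eqP ->; apply/forall_inP => B; rewrite inE.
rewrite negb_forall => /existsP[i]; case lid: (l i) => [//|d] _.
have dq : (d < q)%N by rewrite -lid.
pose lb (k : 'I_d.+1) := interval i (d - k) d.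
(* Each tiling is counted once, as it contains exactly one of the bricks [lb k]. *)
transitivity (\sum_(k < d.+1) \sum_(T | tiling l T && (lb k \in T))
  \prod_(B in T) x #|B|).
  rewrite (exchange_big_dep (tiling l)) /= => [|k T _ /andP[]//].
  apply: eq_bigr => T tT; have [k kT] := exists_last_brick lid dq tT.
  rewrite (big_pred1 k) // => k'; rewrite tT /=; apply/idP/eqP => [k'T|-> //].
  exact: (uniq_last_brick dq tT k'T kT).
rewrite (bigD1 i) //= lid wS mulr_suml; apply: eq_bigr => k _.
rewrite (reindex_onto (fun T => lb k |: T) (fun T => T :\ lb k)) /=; last first.
  by move=> T /andP[_]; apply: setD1K.
have eP T : (tiling l (lb k |: T) && (lb k \in lb k |: T)) && ((lb k |: T) :\ lb k == T)
            = tiling (set_row l i (d - k)) T.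
  rewrite (tiling_add_last lid dq) setU11 andbT; congr (_ && _).
  apply/eqP/idP => [<-|/setU1K //]; by rewrite !inE eqxx.
under eq_bigl do rewrite eP.
transitivity (\sum_(T | tiling (set_row l i (d - k)) T) x k.+1 * \prod_(B in T) x #|B|).
  apply: eq_bigr => T; rewrite (tiling_add_last lid dq) => /andP[_ nT].
  by rewrite big_setU1 //= (card_last_brick _ dq).
have lk : (set_row l i (d - k) i = d - k)%N by rewrite /set_row eqxx.
rewrite -mulr_sumr IHN; first last.
- move=> j; rewrite /set_row; case: eqP => // _.
  by rewrite (leq_trans (leq_subr _ _)) // ltnW.
- rewrite (bigD1 i) //= lk; move: lN; rewrite ltnS; apply: leq_trans.
  rewrite [X in (_ <= X)%N](bigD1 i) //= lid addSn ltnS leq_add ?leq_subr //.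
  by rewrite leq_sum // => j /negbTE; rewrite /set_row => ->.
rewrite (bigD1 i) //= lk mulrA; congr (_ * _); apply: eq_bigr => j /negbTE.
by rewrite /set_row => ->.
Qed.

End Tilings.

(** * Expansions *)

(** The type of the summation index depends on [i], as the tabloids of a component live in its own
    diagram. Tagging the indices by [i] reduces this to distributivity over a single type. *)
Lemma big_dffun_distr (R : comPzSemiRingType) (I : finType) (T_ : I -> finType)
    (P : forall i, T_ i -> R) :
  \prod_i \sum_(j : T_ i) P i j
  = \sum_(t : {dffun forall i : I, T_ i}) \prod_i P i (t i).
Proof.
rewrite (reindex (@dffun_of_fprod I T_)) /=; last exact/onW_bij/dffun_of_fprod_bij.
transitivity (\sum_(t : fprod T_) \prod_(i in I) [ffun j => P i j] (t i)); last first.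
  by apply: eq_bigr => t _; apply: eq_bigr => i _; rewrite !ffunE.
rewrite big_fprod.
transitivity (\prod_i \sum_(j in tagged_with T_ i) untag 0 [ffun j => P i j] j).
  apply: eq_bigr => i _; rewrite -(big_tag (fun i => [ffun j => P i j])).
  by apply: eq_bigr => j _; rewrite ffunE.
exact: bigA_distr_big_dep.
Qed.

Lemma prodN_seq (R : comPzRingType) (I : Type) (s : seq I) (F : I -> R) :
  \prod_(i <- s) (- F i) = (-1) ^+ size s * \prod_(i <- s) F i.
Proof.
elim: s => [|i s IHs]; first by rewrite !big_nil mulr1.
by rewrite !big_cons IHs exprS !mulNr mul1r mulrCA mulrA.
Qed.

Lemma card_region p q (l : 'I_p -> nat) : (forall i, (l i <= q)%N) ->
  #|region q l| = (\sum_i l i)%N.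
Proof.
move=> lq; rewrite -sum1_card.
transitivity (\sum_i \sum_(j < q | (j < l i)%N) 1)%N.
  by rewrite pair_big_dep; apply: eq_bigl => c; rewrite inE.
by apply: eq_bigr => i _; rewrite (big_ord_narrow (lq i)) sum1_card card_ord.
Qed.

Lemma intpart_perm_eq (la mu : intpart) : perm_eq la mu -> la = mu.
Proof.
move=> p; apply: val_inj.
have /andP[s _] := partsP la; have /andP[s' _] := partsP mu.
apply: (sorted_eq (leT := geq)) s s' p; first exact: (rev_trans leq_trans).
by move=> a b; rewrite /geq /= andbC; apply: anti_leq.
Qed.

Definition row_len (la : intpart) (i : 'I_(size la)) : nat := nth 0%N la i.

Lemma row_len_leq (la : intpart) i : (@row_len la i <= head 0%N la)%N.
Proof.
case: la i => [[|d s] h] i; first by case: i.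
have /andP[/= sd _] := h.
rewrite /row_len /=; case: i => [[|i] //= lt_i].
by have /allP := order_path_min (rev_trans leq_trans) sd; apply; apply: mem_nth.
Qed.

(** By conversion, [diagram la] is the region of the row lengths of [la] and a brick is an interval
    of its rectangle. *)
Lemma brick_tabloidsE (la mu : intpart) T :
  (T \in brick_tabloids la mu) =
  tiling (@row_len la) T && perm_eq [seq #|(B : {set cell la})| | B <- enum T] mu.
Proof. by rewrite inE andbA. Qed.

Lemma sumn_row_len (la : intpart) : (\sum_i @row_len la i)%N = sumn la.
Proof. by rewrite sumnE (big_nth 0%N) big_mkord. Qed.

(** Both sides count the cells of the diagram. This makes the content of a family of tilings a type
    of the same [n]. *)
Lemma sumn_brick_tabloid (la mu : intpart) T :
  T \in brick_tabloids la mu -> sumn mu = sumn la.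
Proof.
rewrite brick_tabloidsE => /andP[/andP[pT _] /perm_sumn <-].
rewrite sumnE big_map big_enum /= -(card_partition pT) card_region.
  exact: sumn_row_len.
exact: row_len_leq.
Qed.

Lemma seriesMsignE k (f : series) m : ((-1) ^+ k * f) m = (-1) ^+ k * f m.
Proof.
elim: k => [|k IHk]; first by rewrite !mul1r.
by rewrite !exprS !mulN1r !mulNr seriesNE IHk.
Qed.

Lemma seriesMnE k (f : series) m : (f *+ k) m = f m *+ k.
Proof. by elim: k => // k IHk; rewrite !mulrS seriesDE IHk. Qed.

(** * Sorting families of tilings by content *)

Section Content.

Variables (n : nat) (sigma : typ n).

Let tab : finType := {dffun forall i : 'I_n, {set {set cell (tnth sigma i)}}}.

Definition sizes (T : tab) (i : 'I_n) : seq nat := [seq #|B| | B : {set _} in T i].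

Lemma PTsimpP (rho : typ n) (T : tab) :
  reflect (forall i, tiling (@row_len (tnth sigma i)) (T i) /\
                     perm_eq (sizes T i) (tnth rho i))
          (T \in PTsimp sigma rho).
Proof.
rewrite inE; apply: (iffP forallP) => h i.
  by have := h i; rewrite brick_tabloidsE => /andP.
by rewrite brick_tabloidsE; apply/andP; exact: h.
Qed.

(** Together with [content_uniq], this places each family of tilings in exactly one
    [PTsimp sigma rho]. *)
Lemma exists_content (T : tab) :
  (forall i, tiling (@row_len (tnth sigma i)) (T i)) ->
  exists rho : typ n, T \in PTsimp sigma rho.
Proof.
move=> tT; have partS i : is_part (sort geq (sizes T i)).
  rewrite /is_part sort_sorted ?mem_sort; last by move=> a b; apply: leq_total.
  (* A brick of size 0 would be the empty set, which is not a block of a partition. *)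
  apply/negP; rewrite /= => /imageP[B BT /esym/eqP]; rewrite cards_eq0 => /eqP B0.
  by case/andP: (tT i) => /and3P[_ _ /negP[]]; rewrite -B0.
pose u := [tuple IntPart (partS i) | i < n].
have uT i : T i \in brick_tabloids (tnth sigma i) (tnth u i).
  by rewrite brick_tabloidsE tT tnth_mktuple /= perm_sym perm_sort.
have ut : is_type u.
  rewrite /is_type -[X in _ == X](eqP (typP sigma)); apply/eqP.
  by apply: eq_bigr => i _; rewrite (sumn_brick_tabloid (uT i)).
by exists (Typ ut); rewrite inE; apply/forallP.
Qed.

Lemma content_uniq (T : tab) (rho rho' : typ n) :
  T \in PTsimp sigma rho -> T \in PTsimp sigma rho' -> rho = rho'.
Proof.
move=> /PTsimpP h /PTsimpP h'; apply/val_inj/eq_from_tnth => i; apply: intpart_perm_eq.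
have [_ p] := h i; have [_ p'] := h' i.
by rewrite perm_sym in p; apply: perm_trans p p'.
Qed.

End Content.

(** * Expansion of either family of products in the other *)

Section Expansion.

Variables F G : nat -> series.
Hypotheses (F0 : F 0 = 1) (G0 : G 0 = 1).
Hypothesis FG : forall d, \sum_(k < d.+1) F k * G (d - k)%N = (d == 0%N)%:R.

Lemma psubst_recursion r d : (0 < r)%N ->
  psubst r (G d.+1) = \sum_(k < d.+1) (- psubst r (F k.+1)) * psubst r (G (d - k)%N).
Proof.
move=> r0.
have : \sum_(k < d.+2) psubst r (F k) * psubst r (G (d.+1 - k)%N) = 0.
  under eq_bigr do rewrite -psubstM //.
  rewrite -psubst_sum // FG /=.
  (* In degree [d.+1] the right side of [FG] is 0, and the substitution sends 0 to 0. *)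
  by apply: funext => m; case: psubstP.
rewrite big_ord_recl F0 psubst1 // mul1r subn0 => e.
have -> : psubst r (G d.+1) =
    - \sum_(k < d.+1) psubst r (F k.+1) * psubst r (G (d - k)%N).
  apply/eqP; rewrite -addr_eq0; apply/eqP; exact: e.
by rewrite -sumrN; apply: eq_bigr => k _; rewrite mulNr.
Qed.

Lemma block_prod_tabloids n (sigma : typ n) :
  block_prod G sigma =
  \sum_(rho : typ n) \sum_(T in PTsimp sigma rho) (-1) ^+ typ_len rho * block_prod F rho.
Proof.
rewrite (exchange_big_dep predT) //=.
(* Extending each tiling sum by 0 to all sets of sets of cells gives it a full finite type as range,
   ready for distributivity. *)
transitivity (\prod_(i < n) \sum_(T : {set {set cell (tnth sigma i)}})
   if tiling (@row_len (tnth sigma i)) T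
   then \prod_(B in T) - psubst i.+1 (F #|B|) else 0).
  apply: eq_bigr => i _; rewrite -big_mkcond /=.
  rewrite (tiling_sum (w := fun d => psubst i.+1 (G d))
    (x := fun d => - psubst i.+1 (F d))).
  - by rewrite (big_nth 0%N) big_mkord.
  - by rewrite G0 psubst1.
  - by move=> d; apply: psubst_recursion.
  - exact: row_len_leq.
rewrite big_dffun_distr; apply: eq_bigr => T _.
have [/forallP tT|] :=
  boolP [forall i, tiling (@row_len (tnth sigma i)) (T i)]; last first.
  (* A family with a component that is not a tiling contributes 0 and belongs to no
     [PTsimp sigma rho]. *)
  rewrite negb_forall => /existsP[i /negbTE nT]; rewrite (bigD1 i) //= nT mul0r.
  by rewrite big1 // => rho /PTsimpP/(_ i)[]; rewrite nT.
have [rho Trho] := exists_content tT.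
rewrite (big_pred1 rho) => [|rho' /=]; last first.
  by apply/idP/eqP => [/content_uniq/(_ Trho)|->].
(* Each brick brings one sign, and the bricks of component [i] are as many as the parts of
   [tnth rho i]; in total there are [typ_len rho] signs. *)
transitivity (\prod_(i < n) ((-1) ^+ size (tnth rho i) *
   \prod_(d <- tnth rho i) psubst i.+1 (F d))).
  apply: eq_bigr => i _; rewrite tT; have [_ p] := PTsimpP _ _ Trho i.
  by rewrite -prodN_seq -(perm_big _ p) big_image.
by rewrite big_split /= prodrXr.
Qed.

Lemma expands_tabloids n (sigma : typ n) :
  expands (@block_prod F n) (block_prod G sigma)
    (fun rho => (-1) ^+ typ_len rho * #|PTsimp sigma rho|%:R).
Proof.
move=> m; rewrite block_prod_tabloids series_sumE; apply: eq_bigr => rho _.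
by rewrite sumr_const seriesMnE seriesMsignE mulrnAr mulr1 mulrnAl.
Qed.

End Expansion.

(** * Linear independence *)

(** Convex in the degree and concave in the exponent: it drops both when the degree of a block is
    split among several variables and when two powers are merged on one variable. *)
Definition phi (b : nat * nat) : int := (b.1 ^ 2 * b.2)%N%:Z - (b.1 * b.2 ^ 2)%N%:Z.

Definition Phi (s : seq (nat * nat)) : int := \sum_(b <- s) phi b.

Definition profile (m : monom) : seq (nat * nat) :=
  [seq (vdeg v, m v) | v <- finsupp m].

Lemma Phi_profile (m : monom) (K : {fset var}) : (finsupp m `<=` K)%fset ->
  Phi (profile m) = \sum_(v <- K) phi (vdeg v, m v).
Proof.
move=> s; rewrite /Phi big_map; apply: (big_fset_incl _ s) => v _ /fsfun_dflt ->.
by rewrite /phi /= !muln0.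
Qed.

(** The triangularity relation. A tie in [Phi] is accepted only with equal multisets, since distinct
    multisets may have the same [Phi]. *)
Definition dominated (m : monom) (s : seq (nat * nat)) : Prop :=
  Phi (profile m) < Phi s \/ perm_eq (profile m) s.

Lemma dominated_le m s : dominated m s -> Phi (profile m) <= Phi s.
Proof. by case=> [/ltW //|p]; rewrite /Phi (perm_big _ p). Qed.

Lemma profileM_disjoint (a b : monom) : [disjoint finsupp a & finsupp b]%fset ->
  perm_eq (profile (a ** b)) (profile a ++ profile b).
Proof.
move=> dab; have p : perm_eq (finsupp (a ** b)) (finsupp a ++ finsupp b).
  apply: uniq_perm => [||v]; rewrite ?fset_uniq ?cat_uniq ?fset_uniq /= ?andbT //.
    apply/hasPn => v vb; apply/negP => va.
    by have /fdisjointP/(_ v va) := dab; rewrite vb.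
  by rewrite mdomD in_fsetU mem_cat.
apply: perm_trans (perm_map _ p) _; rewrite map_cat.
have -> : [seq (vdeg v, (a ** b) v) | v <- finsupp a] = profile a.
  by apply/eq_in_map => v /(fdisjointP dab)/fsfun_dflt vb; rewrite cmM vb addn0.
have -> : [seq (vdeg v, (a ** b) v) | v <- finsupp b] = profile b.
  rewrite fdisjoint_sym in dab.
  by apply/eq_in_map => v /(fdisjointP dab)/fsfun_dflt va; rewrite cmM va.
by [].
Qed.

Lemma phiD d x y : phi (d, (x + y)%N) = phi (d, x) + phi (d, y) - (2 * (d * x * y))%N%:Z.
Proof. rewrite /phi /=; lia. Qed.

(** With disjoint supports the profiles simply concatenate. By [phiD], each shared variable costs
    the positive amount [2 * d * x * y], where [d] is its degree and [x], [y] are its exponents. *)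
Lemma dominated_mul (a b : monom) : dominated (a ** b) (profile a ++ profile b).
Proof.
have [|] := boolP [disjoint finsupp a & finsupp b]%fset.
  by move=> /profileM_disjoint; right.
rewrite -fsetI_eq0 => /fset0Pn[v]; rewrite in_fsetI -!cmE_neq0 => /andP[va vb].
left; rewrite /Phi big_cat -!/(Phi _) /=.
rewrite (@Phi_profile _ (finsupp a `|` finsupp b)%fset) ?mdomD //.
rewrite (Phi_profile (fsubsetUl (finsupp a) (finsupp b))).
rewrite (Phi_profile (fsubsetUr (finsupp a) (finsupp b))) -big_split /=.
have vK : v \in (finsupp a `|` finsupp b)%fset by rewrite in_fsetU -!cmE_neq0 va.
rewrite (big_fsetD1 v) //= [ltRHS](big_fsetD1 v) //=; apply: ltr_leD.
  rewrite cmM phiD ltrBlDr ltrDl ltz_nat !muln_gt0 /=.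
  by rewrite !lt0n va vb.
by apply: ler_sum => u _; rewrite cmM phiD lerBlDr lerDl.
Qed.

Lemma dominated_cat (a b : monom) s t : dominated a s -> dominated b t ->
  dominated (a ** b) (s ++ t).
Proof.
move=> da db; have la := dominated_le da; have lb := dominated_le db.
have PC u v : Phi (u ++ v) = Phi u + Phi v by rewrite /Phi big_cat.
have [lt|p] := dominated_mul a b.
  by left; rewrite PC; rewrite PC in lt; apply: lt_le_trans lt _; apply: lerD.
have ep : Phi (profile (a ** b)) = Phi (profile a ++ profile b) := perm_big _ p.
case: da => [lta|pa]; first by left; rewrite ep !PC; apply: ltr_leD.
case: db => [ltb|pb]; first by left; rewrite ep !PC; apply: ler_ltD.
by right; apply: perm_trans p _; apply: perm_cat.
Qed.

Lemma profile_mpowU r v : (0 < r)%N -> profile (mpow r (ucm v)) = [:: (vdeg v, r)].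
Proof.
move=> r0; apply: perm_small_eq => //.
suff p : perm_eq (finsupp (mpow r (ucm v))) [:: v].
  by apply: perm_trans (perm_map _ p) _; rewrite /= mpowE cmUU muln1.
by apply: uniq_perm => [||u]; rewrite ?fset_uniq // finsupp_mpow // mdomU in_fset1 inE.
Qed.

(* With [d = wdeg f], expand one factor [d] in each product of [d^2 r - d r^2] as
   the sum of the [vdeg v * f v] and compare termwise, using [vdeg v <= d] and
   [1 <= f v]; equality everywhere forces [f] to be a single variable. *)
Lemma dominated_mpow r (f : monom) : (0 < r)%N -> (0 < wdeg f)%N ->
  dominated (mpow r f) [:: (wdeg f, r)].
Proof.
move=> r0 f0; set d := wdeg f in f0 *.
have dle v : v \in finsupp f -> (vdeg v <= d)%N.
  move=> vf; rewrite /d /wdeg (big_fsetD1 v) //=.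
  by apply: leq_trans (leq_addr _ _); rewrite leq_pmulr // lt0n cmE_neq0.
have fpos v : v \in finsupp f -> (0 < f v)%N by rewrite lt0n cmE_neq0.
have le1 Y x : (Y <= d)%N -> (Y ^ 2 * (r * x) <= d * r * (Y * x))%N.
  have -> : (Y ^ 2 * (r * x) = Y * (r * (Y * x)))%N by lia.
  by rewrite -mulnA leq_mul2r => ->; rewrite orbT.
have le2 Y x : (0 < x)%N -> (r ^ 2 * (Y * x) <= Y * (r * x) ^ 2)%N.
  have -> : (Y * (r * x) ^ 2 = r ^ 2 * (Y * x) * x)%N by rewrite expnMn; lia.
  exact: leq_pmulr.
have le v : v \in finsupp f ->
    phi (vdeg v, mpow r f v) <=
    (d * r)%:Z * (vdeg v * f v)%N%:Z - (r ^ 2)%N%:Z * (vdeg v * f v)%N%:Z.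
  move=> vf; rewrite /phi /= mpowE -!PoszM.
  by apply: lerB; rewrite lez_nat ?le1 ?le2 ?dle ?fpos.
have PE : Phi (profile (mpow r f)) = \sum_(v <- finsupp f) phi (vdeg v, mpow r f v).
  by apply: Phi_profile; rewrite finsupp_mpow.
have SE : Phi [:: (d, r)] =
   \sum_(v <- finsupp f)
     ((d * r)%:Z * (vdeg v * f v)%N%:Z - (r ^ 2)%N%:Z * (vdeg v * f v)%N%:Z).
  rewrite sumrB -!mulr_sumr -!(big_morph _ PoszD (erefl 0%:Z)) -/(wdeg f) -/d.
  rewrite /Phi big_seq1 /phi /=; lia.
have [/hasP[v vf vlt]|/hasPn nh] :=
    boolP (has (fun v => (vdeg v < d) || (1 < f v))%N (finsupp f)).
  left; rewrite PE SE (big_fsetD1 v) //= [ltRHS](big_fsetD1 v) //=; apply: ltr_leD.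
    rewrite /phi /= mpowE -!PoszM.
    have Y0 : (0 < vdeg v)%N by [].
    case/orP: vlt => [vd|fv].
      apply: ltr_leD; rewrite ?lerN2 ?ltz_nat ?lez_nat ?le2 ?fpos //.
        have -> : (vdeg v ^ 2 * (r * f v) = vdeg v * (r * (vdeg v * f v)))%N by lia.
        by rewrite -mulnA ltn_mul2r vd !muln_gt0 r0 fpos.
    apply: ler_ltD; rewrite ?ltrN2 ?ltz_nat ?lez_nat ?le1 ?dle //.
      have -> : (vdeg v * (r * f v) ^ 2 = (r ^ 2 * (vdeg v * f v)) * f v)%N.
        by rewrite expnMn; lia.
      by rewrite ltn_Pmulr // !muln_gt0 r0 fpos.
  rewrite big_seq [leRHS]big_seq; apply: ler_sum => u; rewrite in_fsetD1 => /andP[_].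
  exact: le.
right.
have [v vf] : exists v, v \in finsupp f.
  apply/fset0Pn; apply: contraTneq f0 => e.
  by rewrite /d /wdeg e big_seq_fset0.
have f1 u : u \in finsupp f -> vdeg u = d /\ f u = 1%N.
  move=> uf; have := nh u uf; rewrite negb_or -!leqNgt => /andP[h1 h2].
  split; apply/eqP; rewrite eqn_leq ?dle ?h1 ?h2 ?fpos //.
have fv : f = ucm v.
  apply: monomP => u; rewrite cmU.
  case: eqP => [<-|/eqP uv]; first by have [] := f1 v vf.
  case: (finsuppP f u) => // uf; have := erefl d; rewrite {1}/d /wdeg.
  rewrite (big_fsetD1 v) //= (big_fsetD1 u) /=; last by rewrite in_fsetD1 eq_sym uv.
  have [-> ->] := f1 v vf; have [-> ->] := f1 u uf; lia.
by rewrite {1}fv profile_mpowU //; have [<- _] := f1 v vf.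
Qed.

(** * Monomials occurring in a product over a list of blocks *)

Definition Hseq (s : seq (nat * nat)) : series := \prod_(b <- s) psubst b.2 (Hdeg b.1).

Definition posb (b : nat * nat) : bool := (0 < b.1)%N && (0 < b.2)%N.

Lemma psubst_H_dominated b (m : monom) : posb b ->
  psubst b.2 (Hdeg b.1) m != 0 -> dominated m [:: b].
Proof.
case: b => d r /andP[/= d0 r0]; case: psubstP => // a ->.
rewrite /Hdeg; have [e _|_] := eqVneq (wdeg a) d; last by rewrite eqxx.
rewrite -e in d0 *.
exact: dominated_mpow.
Qed.

Lemma Hseq_dominated s (m : monom) : all posb s -> Hseq s m != 0 -> dominated m s.
Proof.
elim: s m => [m _|b s IHs m /= /andP[b0 s0]]; rewrite /Hseq.
  rewrite big_nil series1E; have [-> _|_] := eqVneq m mone; last by rewrite eqxx.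
  right.
  by rewrite /profile mdom1.
rewrite big_cons seriesME => nz.
have /hasP[a] : has (fun a => psubst b.2 (Hdeg b.1) a * Hseq s (divcm m a) != 0) (divs m).
  apply: contraNT nz => /hasPn h; rewrite big_seq big1 // => a /h.
  by rewrite negbK => /eqP.
rewrite mem_divs mulf_eq0 negb_or => /eqP e /andP[h1 h2]; rewrite -e -cat1s.
by apply: dominated_cat; [apply: psubst_H_dominated|apply: IHs].
Qed.

(* The second index of each variable, the number of blocks that follow, keeps
   the variables distinct. *)
Fixpoint witness (s : seq (nat * nat)) : monom :=
  if s is b :: s' then mpow b.2 (ucm ((b.1.-1, size s') : var)) ** witness s' else mone.

Lemma finsupp_witness s v : all posb s -> v \in finsupp (witness s) -> (v.2 < size s)%N.
Proof.
elim: s => [_|b s IHs /= /andP[/andP[_ b0] s0]]; first by rewrite mdom1.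
rewrite mdomD in_fsetU finsupp_mpow // mdomU in_fset1 => /orP[/eqP -> //|/(IHs s0)].
exact: ltnW.
Qed.

Lemma profile_witness s : all posb s -> perm_eq (profile (witness s)) s.
Proof.
elim: s => [_|b s IHs /= /andP[b0 s0]]; first by rewrite /profile mdom1.
have /andP[d0 r0] := b0.
apply: perm_trans (profileM_disjoint _) _.
  apply/fdisjointP => v; rewrite finsupp_mpow // mdomU in_fset1 => /eqP ->.
  by apply/negP => /(finsupp_witness s0) /=; rewrite ltnn.
rewrite profile_mpowU // /vdeg /= prednK // -surjective_pairing perm_cons.
exact: IHs.
Qed.

Lemma psubst_H_ge0 b (m : monom) : posb b -> 0 <= psubst b.2 (Hdeg b.1) m.
Proof. by case/andP=> _ r0; case: psubstP => // a _; rewrite /Hdeg ler0n. Qed.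

Lemma Hseq_ge0 s m : all posb s -> 0 <= Hseq s m.
Proof.
elim: s m => [m _|b s IHs m /= /andP[b0 s0]]; rewrite /Hseq.
  by rewrite big_nil series1E ler0n.
rewrite big_cons seriesME; apply: sumr_ge0 => a _.
by rewrite mulr_ge0 ?psubst_H_ge0 ?IHs.
Qed.

(** All coefficients are nonnegative, so nothing cancels, and the one term that splits off the
    variable of the first block is already positive. *)
Lemma Hseq_witness s : all posb s -> 0 < Hseq s (witness s).
Proof.
elim: s => [_|b s IHs /= /andP[b0 s0]]; rewrite /Hseq.
  by rewrite big_nil series1E eqxx.
have /andP[d0 r0] := b0.
rewrite big_cons seriesME; set a := mpow _ _.
rewrite (bigD1_seq a) ?divs_uniq ?mem_divs_mull //= ltr_wpDr //.
  by apply: sumr_ge0 => c _; rewrite mulr_ge0 ?psubst_H_ge0 // -/(Hseq _) Hseq_ge0.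
rewrite divcm_mul mulr_gt0 ?IHs // psubst_mpow // /Hdeg.
by rewrite /wdeg mdomU big_seq_fset1 cmUU muln1 /vdeg /= prednK ?eqxx.
Qed.

(** * Independence of the [Hpoly rho] *)

Section Independence.

Variable n : nat.
Implicit Types rho : typ n.

Definition blocks rho : seq (nat * nat) :=
  [seq (d, (val i).+1) | i <- enum 'I_n, d <- tnth rho i].

Lemma blocks_pos rho : all posb (blocks rho).
Proof.
apply/allP => b /allpairsPdep[i [d [_ dr ->]]]; rewrite /posb /= andbT lt0n.
by have /andP[_] := partsP (tnth rho i); apply: contraNneq => <-.
Qed.

Lemma HpolyE rho : Hpoly rho = Hseq (blocks rho).
Proof. by rewrite /Hseq big_allpairs_dep big_enum. Qed.

Lemma count_blocks rho (p : pred (nat * nat)) :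
  count p (blocks rho) = (\sum_(i < n) count (fun d => p (d, i.+1)) (tnth rho i))%N.
Proof.
rewrite count_flatten sumnE big_map big_map big_enum; apply: eq_bigr => i _.
by rewrite count_map.
Qed.

(** The parts of component [i] are recovered by counting the blocks of multiplicity [i.+1]. *)
Lemma blocks_perm_inj rho rho' : perm_eq (blocks rho) (blocks rho') -> rho = rho'.
Proof.
move=> /permP pb; apply/val_inj/eq_from_tnth => i; apply: intpart_perm_eq.
apply/permP => a.
have ce (r : typ n) : count a (tnth r i) =
    count (fun b => a b.1 && (b.2 == i.+1)) (blocks r).
  rewrite count_blocks (bigD1 i) //= big1 => [|j ji].
    by rewrite addn0; apply: eq_count => d; rewrite eqxx andbT.
  rewrite -(count_pred0 (tnth r j)); apply: eq_count => d /=.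
  by rewrite eqSS val_eqE (negbTE ji) andbF.
by rewrite !ce pb.
Qed.

Lemma Hpoly_independent (c : typ n -> rat) :
  (forall m, \sum_rho c rho * Hpoly rho m = 0) -> forall rho, c rho = 0.
Proof.
move=> c0 rho; apply: contrapT => /eqP crho.
(* Among the types with nonzero coefficient, [rho1] has the largest [Phi]; its witness monomial will
   isolate it in the relation. *)
pose rho1 := [arg max_(r > rho | c r != 0) Phi (blocks r)]%O.
have [c1 max1] : c rho1 != 0 /\ forall r, c r != 0 -> Phi (blocks r) <= Phi (blocks rho1).
  by rewrite /rho1; case: Order.TotalTheory.arg_maxP.
have pw := profile_witness (blocks_pos rho1).
have := c0 (witness (blocks rho1)); rewrite (bigD1 rho1) //= big1 => [/eqP|r rr1].
  rewrite addr0 mulf_eq0 (negbTE c1) /= HpolyE.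
  by rewrite gt_eqF // Hseq_witness // blocks_pos.
have [->|cr] := eqVneq (c r) 0; first by rewrite mul0r.
rewrite HpolyE; apply/eqP; rewrite mulf_eq0; apply/orP; right.
(* If the witness occurred in [Hpoly r], then either [Phi (blocks r)] would exceed the maximum, or
   [r] would have the blocks of [rho1] and equal it. *)
apply: contraNT rr1 => /(Hseq_dominated (blocks_pos r)) [lt|p].
  move: lt; rewrite {1}/Phi (perm_big _ pw) -/(Phi _) ltNge.
  by rewrite max1.
apply/eqP/blocks_perm_inj; rewrite perm_sym; apply: perm_trans p.
by rewrite perm_sym.
Qed.

End Independence.

(** * Transfer of independence and uniqueness of coefficients *)

Definition independent n (B : typ n -> series) : Prop :=
  forall c : typ n -> rat, (forall m, \sum_rho c rho * B rho m = 0) ->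
  forall rho, c rho = 0.

(** Expanding [A] in [B] and back gives [M^2 = 1] by independence of [A]. A relation [c] among the
    [B rho] becomes the relation [c M] among the [A rho], so [c M = 0] and [c = (c M) M = 0]. *)
Lemma independent_transition n (A B : typ n -> series) (M : typ n -> typ n -> rat) :
  (forall sigma, expands B (A sigma) (M sigma)) ->
  (forall sigma, expands A (B sigma) (M sigma)) ->
  independent A -> independent B.
Proof.
move=> AB BA indA.
have expand c m : \sum_rho c rho * B rho m
    = \sum_tau (\sum_rho c rho * M rho tau) * A tau m.
  under eq_bigr do rewrite BA mulr_sumr; rewrite exchange_big /=.
  apply: eq_bigr => tau _; rewrite mulr_suml.
  by apply: eq_bigr => rho _; rewrite mulrA.
have MM sigma tau : \sum_rho M sigma rho * M rho tau = (sigma == tau)%:R.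
  apply/eqP; rewrite -subr_eq0; apply/eqP; move: tau; apply: indA => m.
  under eq_bigr do rewrite mulrBl; rewrite sumrB -expand -AB.
  rewrite (bigD1 sigma) //= eqxx mul1r big1 ?addr0 ?subrr // => rho.
  by rewrite eq_sym => /negbTE ->; rewrite mul0r.
move=> c cB tau; have cM := indA _ (fun m => etrans (esym (expand c m)) (cB m)).
transitivity (\sum_rho c rho * \sum_kappa M rho kappa * M kappa tau).
  under eq_bigr do rewrite MM.
  rewrite (bigD1 tau) //= eqxx mulr1 big1 ?addr0 // => rho /negbTE ->.
  by rewrite mulr0.
under eq_bigr do rewrite mulr_sumr; rewrite exchange_big big1 //= => kappa _.
by under eq_bigr do rewrite mulrA; rewrite -mulr_suml cM mul0r.
Qed.

Lemma independent_is_coef n (B : typ n -> series) f c tau :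
  independent B -> expands B f c -> is_coef B f tau (c tau).
Proof.
move=> indB fc; exists c; split=> // c' fc' rho; apply/eqP; rewrite -subr_eq0.
apply/eqP; move: rho; apply: indB => m.
by under eq_bigr do rewrite mulrBl; rewrite sumrB -fc -fc' subrr.
Qed.

Lemma sum_HE d : \sum_(k < d.+1) Hdeg k * Edeg (d - k) = (d == 0%N)%:R.
Proof.
rewrite -sum_EH (reindex_inj rev_ord_inj) /=; apply: eq_bigr => k _.
by rewrite subSS subKn 1?mulrC // -ltnS.
Qed.

Theorem theorem35 (n : nat) (sigma tau : typ n) :
  is_coef (@Epoly n) (Hpoly sigma) tau
    ((-1) ^+ typ_len tau * #|PTsimp sigma tau|%:R)
  /\
  is_coef (@Hpoly n) (Epoly sigma) tau
    ((-1) ^+ typ_len tau * #|PTsimp sigma tau|%:R).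
Proof.
(* Both instances have the same coefficient matrix, as [independent_transition] requires. *)
have HE := expands_tabloids Edeg0 Hdeg0 sum_EH.
have EH := expands_tabloids Hdeg0 Edeg0 sum_HE.
have indH : independent (@Hpoly n) := @Hpoly_independent n.
have indE : independent (@Epoly n) := independent_transition (HE n) (EH n) indH.
split; [exact: independent_is_coef indE (HE n sigma)|
        exact: independent_is_coef indH (EH n sigma)].
Qed.
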